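(* Let $R$ be a pseudo-valuation domain (PVD) which is not a field, $V$ its associated valuation overring, $M$ its maximal ideal, $k=R/M$ its residue field, $K=V/M$, and suppose that $R\subsetneq V$. Let $L$ be the quotient field of $R$, $SD(R)$ the set of nonzero strongly divisorial ideals of $R$, $O_t(R)$ the set of $t$-linked overrings of $R$, and $\phi_R: SD(R)\to O_t(R)\setminus\{L\}$ the map $I\mapsto I^{-1}=(I:I)$. The following statements are equivalent: (i) $\phi_R$ is surjective; (ii) the extension $R\subset V$ is minimal, i.e. there are no rings properly between $R$ and $V$; (iii) $K$ is algebraic over $k$, and $K=k(\alpha)$ for each $\alpha\in K\setminus k$; (iv) $O(R)=\{R\}\cup O(V)$. Moreover, if $\dim V=n$ is finite, then $R$ is an FO-domain and $R$ has exactly $n+1$ strongly divisorial ideals $\{P_1,P_2,\dots,P_{n-1},M,R\}$, where $P_1,P_2,\dots,P_{n-1},M$ are the nonzero prime ideals of $R$.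
   Context: An integral domain $R$ is a pseudo-valuation domain (PVD) if there is a valuation overring $V$ of $R$ with $\mathrm{Spec}(R)=\mathrm{Spec}(V)$ (equality as sets of ideals); $V$ is its associated valuation overring, and $R$ is local with the same maximal ideal $M$ as $V$. An overring of a domain $R$ with quotient field $L$ is a ring $T$ with $R\subseteq T\subseteq L$; $O(R)$ denotes the set of all overrings of $R$, and $R$ is an FO-domain if $O(R)$ is finite. $\dim$ denotes Krull dimension. For a nonzero fractional ideal $I$ of $R$, $I^{-1}=(R:I)=\{x\in L: xI\subseteq R\}$, $I_v=(I^{-1})^{-1}$, $(I:I)=\{x\in L: xI\subseteq I\}$. An overring $T$ is $t$-linked over $R$ if, for each finitely generated ideal $I$ of $R$, $I^{-1}=R$ implies $(T:IT)=\{x\in L: xIT\subseteq T\}=T$. A nonzero ideal $I$ of $R$ is strongly divisorial if $I=II^{-1}=I_v$ (the ideal $R$ itself is strongly divisorial); in that case $I^{-1}=(I:I)$ is a $t$-linked overring of $R$ different from $L$, so $\phi_R$ is well defined. *)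

(* Defs.v *)
From HB Require Import structures.
From mathcomp Require Import all_boot all_order all_algebra.
From mathcomp Require Import generic_quotient ring_quotient.
From mathcomp Require Import boolp classical_sets functions cardinality.
Set Implicit Arguments.
Unset Strict Implicit.
Unset Printing Implicit Defensive.
Import GRing.Theory.
Local Open Scope classical_set_scope.
Local Open Scope card_scope.
Local Open Scope quotient_scope.
Local Open Scope ring_scope.

(* A domain and its overrings are subrings, given as sets, of an ambient     *)
(* field L; [quotient_field R] says that L is the quotient field of R.       *)
Section Domains.
Variable L : fieldType.
Implicit Types (R A T V I J M P : set L).

Definition subring A : Prop := subring_closed (mem A).

Definition quotient_field R : Prop :=
  forall x : L, exists a b, [/\ R a, R b, b != 0 & x = a / b].

Definition is_field R : Prop := forall x, R x -> x != 0 -> R x^-1.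

Definition ideal A I : Prop :=
  [/\ I `<=` A, I 0, forall x y, I x -> I y -> I (x + y)
    & forall a x, A a -> I x -> I (a * x)].

Definition prime_ideal A P : Prop :=
  [/\ ideal A P, ~ P 1 & forall x y, A x -> A y -> P (x * y) -> P x \/ P y].

Definition maximal_ideal A M : Prop :=
  [/\ ideal A M, ~ M 1
    & forall I, ideal A I -> M `<=` I -> I = M \/ I = A].

Definition spec A : set (set L) := [set P | prime_ideal A P].

Definition nonzero_primes A : set (set L) := spec A `\ [set 0].

Definition prime_chain A (m : nat) (C : nat -> set L) : Prop :=
  (forall i, (i <= m)%N -> prime_ideal A (C i)) /\
  (forall i, (i < m)%N -> C i `<` C i.+1).

Definition krull_dim A (n : nat) : Prop :=
  (exists C, prime_chain A n C) /\
  (forall m C, prime_chain A m C -> (m <= n)%N).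

Definition overrings R : set (set L) := [set T | subring T /\ R `<=` T].

Definition FO_domain R : Prop := finite_set (overrings R).

Definition valuation_overring R V : Prop :=
  overrings R V /\ forall x : L, x != 0 -> V x \/ V x^-1.

Definition pvd_with R V : Prop := valuation_overring R V /\ spec R = spec V.

Definition minimal_extension R V : Prop :=
  R `<` V /\
  forall T, subring T -> R `<=` T -> T `<=` V -> T = R \/ T = V.

Definition colon A I : set L := [set x | forall y, I y -> A (x * y)].

Definition inv_ideal R I : set L := colon R I.

Definition v_closure R I : set L := inv_ideal R (inv_ideal R I).

Definition prod_ideal I J : set L :=
  [set x | exists n (a b : 'I_n -> L),
     [/\ forall i, I (a i), forall i, J (b i) & x = \sum_i a i * b i]].

Definition fg_ideal R I : Prop :=
  exists n (g : 'I_n -> L), (forall i, R (g i)) /\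
    I = [set x | exists c : 'I_n -> L,
           (forall i, R (c i)) /\ x = \sum_i c i * g i].

Definition t_linked_overrings R : set (set L) :=
  [set T | overrings R T /\
     forall I, fg_ideal R I -> inv_ideal R I = R ->
       colon T (prod_ideal I T) = T].

Definition strongly_divisorial R : set (set L) :=
  [set I | [/\ ideal R I, I != [set 0],
               I = prod_ideal I (inv_ideal R I) & I = v_closure R I]].

(* phi_R is I |-> I^-1 from SD(R) to O_t(R) \ {L}. *)
Definition phi_surjective R : Prop :=
  set_surj (strongly_divisorial R) (t_linked_overrings R `\ [set: L])
    (inv_ideal R).

Lemma pvd_with_subring R V : pvd_with R V -> subring V.
Proof. by case=> -[[]]. Qed.

Lemma pvd_with_sub R V : pvd_with R V -> R `<=` V.
Proof. by case=> -[[]]. Qed.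

Lemma subring1 A : subring A -> A 1.
Proof. by case=> /set_mem. Qed.

Lemma subringB A : subring A -> forall x y, A x -> A y -> A (x - y).
Proof.
by case=> _ AB _ x y Ax Ay; apply: set_mem; apply: AB; apply: mem_set.
Qed.

Lemma subringM A : subring A -> forall x y, A x -> A y -> A (x * y).
Proof.
by case=> _ _ AM x y Ax Ay; apply: set_mem; apply: AM; apply: mem_set.
Qed.

Lemma idealN A I x : subring A -> ideal A I -> I x -> I (- x).
Proof.
move=> sA [_ _ _ IM] Ix; rewrite -mulN1r; apply: IM => //.
rewrite -[- 1]add0r; apply: (subringB sA); last exact: subring1.
by rewrite -(subrr 1); apply: (subringB sA); apply: subring1.
Qed.

Lemma maximal_inv A M x : subring A -> maximal_ideal A M ->
  A x -> ~ M x -> exists2 y, A y & M (y * x - 1).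
Proof.
move=> sA [iM M1 maxM] Ax nMx; have [MA M0 MD MM] := iM.
pose J := [set z | exists m a, [/\ M m, A a & z = m + a * x]].
have A0 : A 0 by apply: MA.
have iJ : ideal A J.
  split.
  - move=> _ [m [a [Mm Aa ->]]].
    have Aax := subringM sA Aa Ax.
    rewrite -[a * x]opprK; apply: (subringB sA); first exact: MA.
    by rewrite -[- _]add0r; apply: (subringB sA).
  - by exists 0, 0; rewrite mul0r addr0.
  - move=> _ _ [m [a [Mm Aa ->]]] [m' [a' [Mm' Aa' ->]]].
    exists (m + m'), (a + a'); split; [exact: MD| |by rewrite mulrDl addrACA].
    rewrite -[a']opprK; apply: (subringB sA) => //.
    by rewrite -[- _]add0r; apply: (subringB sA).
  - move=> b _ Ab [m [a [Mm Aa ->]]]; exists (b * m), (b * a).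
    by split; [exact: MM|exact: (subringM sA)|rewrite mulrDr mulrA].
have MJ : M `<=` J by move=> m Mm; exists m, 0; rewrite mul0r addr0.
have [JM|JA] := maxM J iJ MJ.
  case: nMx; rewrite -JM; exists 0, 1; rewrite mul1r add0r; split=> //.
  exact: subring1.
have : J 1 by rewrite JA; apply: subring1.
case=> m [a [Mm Aa e]]; exists a => //.
have -> : a * x - 1 = - m by rewrite e opprD addrC subrK.
exact: (idealN sA iM).
Qed.

Lemma maximal_prime A M : subring A -> maximal_ideal A M -> prime_ideal A M.
Proof.
move=> sA hM; have [iM M1 _] := hM; split=> // x y Ax Ay Mxy.
have [|nMx] := pselect (M x); first by left.
have [z Az Mzx] := maximal_inv sA hM Ax nMx; right.
have [_ _ MD MM] := iM.
have -> : y = z * (x * y) + - (y * (z * x - 1)).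
  by rewrite mulrBr mulr1 opprB addrCA mulrA [y * _]mulrC subrr addr0.
by apply: MD; [exact: MM|apply: (idealN sA iM); apply: MM].
Qed.

Lemma pvd_with_maximal R V M :
  subring R -> pvd_with R V -> maximal_ideal R M -> maximal_ideal V M.
Proof.
move=> sR hV hM; have sV := pvd_with_subring hV.
have [[_ valV] sp] := hV; have RV := pvd_with_sub hV.
have [iRM M1 maxM] := hM.
have primeE P : prime_ideal R P <-> prime_ideal V P.
  by have := sp; rewrite /spec => /predeqP/(_ P).
have [iVM _ _] : prime_ideal V M by apply/primeE; apply: maximal_prime.
have [MV M0 MD MM] := iVM.
pose N := [set x | V x /\ ~ (x != 0 /\ V x^-1)].
have idealsN I : ideal V I -> ~ I 1 -> I `<=` N.
  move=> [IV _ _ IM] I1 x Ix; split; first exact: IV.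
  by case=> x0 Vx; apply: I1; rewrite -(mulVf x0); apply: IM.
have NM' a x : V a -> N x -> N (a * x).
  move=> Va [Vx nx]; split; first exact: (subringM sV).
  case=> + Vax; rewrite mulf_eq0 => /norP[a0 x0]; apply: nx; split=> //.
  have -> : x^-1 = a * (a * x)^-1 by rewrite invfM mulrA divff// mul1r.
  exact: (subringM sV).
have V1 := subring1 sV.
have V0 : V 0 by apply: MV.
have VD x y : V x -> V y -> V (x + y).
  move=> Vx Vy; rewrite -[y]opprK; apply: (subringB sV) => //.
  by rewrite -[- _]add0r; apply: (subringB sV).
have N0 : N 0 by split=> // -[]; rewrite eqxx.
have ND x y : N x -> N y -> N (x + y).
  move=> Nx Ny.
  have [->|x0] := eqVneq x 0; first by rewrite add0r.
  have [->|y0] := eqVneq y 0; first by rewrite addr0.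
  have xy0 : x / y != 0 by rewrite mulf_neq0 ?invr_eq0.
  case: (valV (x / y) xy0) => Vxy.
    have -> : x + y = (x / y + 1) * y by rewrite mulrDl mul1r divfK.
    by apply: NM' => //; apply: VD.
  have -> : x + y = ((x / y)^-1 + 1) * x.
    by rewrite invfM invrK mulrDl mul1r mulrAC mulVf// mul1r addrC.
  by apply: NM' => //; apply: VD.
have iN : ideal V N by split=> // x [].
have N1 : ~ N 1 by case=> _; apply; rewrite invr1 oner_neq0.
have pN : prime_ideal V N.
  split=> // x y Vx Vy [_ nxy].
  have [Nx|nNx] := pselect (N x); [by left|right; split=> // -[y0 Vy']].
  apply: nNx; split=> // -[x0 Vx']; apply: nxy; rewrite mulf_neq0//; split=> //.
  by rewrite invfM; apply: (subringM sV).
have MN : M `<=` N by exact: idealsN.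
have NEM : N = M.
  have [iRN _ _] : prime_ideal R N by apply/primeE.
  have [//|NR] := maxM N iRN MN.
  by case: N1; rewrite NR; exact: subring1.
split=> // I iI MI.
have [I1|nI1] := pselect (I 1).
  right; have [IV _ _ IM] := iI; apply/seteqP; split=> // x Vx.
  by rewrite -[x]mulr1; apply: IM.
left; apply/seteqP; split=> //; rewrite -NEM; exact: idealsN.
Qed.

End Domains.

Section SubringType.
Variables (L : fieldType) (A : set L).

Definition subring_type (sA : subring A) : Type := {x : L | x \in A}.

Variable sA : subring A.

HB.instance Definition _ := [isSub of subring_type sA for @sval _ _].
HB.instance Definition _ := [Choice of subring_type sA by <:].
HB.instance Definition _ :=
  GRing.SubChoice_isSubComNzRing.Build L (fun x => x \in A) (subring_type sA)
    sA.

End SubringType.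

Section ResidueField.
Variables (L : fieldType) (A M : set L).
Variables (sA : subring A) (hM : maximal_ideal A M).

Definition residue_ideal of maximal_ideal A M : {pred subring_type sA} :=
  fun x => val x \in M.

Lemma residue_ideal_closed : idealr_closed (residue_ideal hM).
Proof.
have [[_ M0 MD MM] M1 _] := hM.
split; rewrite ?unfold_in ?rmorph0 ?rmorph1.
- exact: mem_set.
- by apply/negP => /set_mem.
move=> a u v; rewrite !unfold_in => /set_mem Mu /set_mem Mv.
rewrite rmorphD rmorphM; apply: mem_set; apply: MD => //; apply: MM => //.
exact: (set_mem (valP a)).
Qed.

HB.instance Definition _ :=
  isIdealr.Build (subring_type sA) (residue_ideal hM) residue_ideal_closed.

Definition residue_field : Type := {ideal_quot (residue_ideal hM)}.

HB.instance Definition _ := GRing.ComNzRing.on residue_field.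

Definition residue (x : subring_type sA) : residue_field :=
  \pi_({ideal_quot (residue_ideal hM)}) x.

HB.instance Definition _ := GRing.RMorphism.copy residue
  (\pi_({ideal_quot (residue_ideal hM)})).

End ResidueField.
Arguments residue {L A M} sA hM x.

Section ResidueFieldInstance.
Variables (L : fieldType) (A M : set L).
Variables (sA : subring A) (hM : maximal_ideal A M).
Local Notation K := (residue_field sA hM).

Lemma residue_surj (x : K) : exists a : subring_type sA, x = residue sA hM a.
Proof. by exists (repr x); rewrite /residue reprK. Qed.

Lemma residue_eq (a b : subring_type sA) :
  residue sA hM a = residue sA hM b <-> M (val a - val b).
Proof.
rewrite -rmorphB; split.
  by move=> /eqP; rewrite /residue -Quotient.idealrBE => /set_mem.
by move=> Mab; apply/eqP; rewrite /residue -Quotient.idealrBE; apply: mem_set.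
Qed.

Lemma residue_has_inv (x : K) : exists y : K,
  (x <> 0 -> y * x = 1) /\ (x = 0 -> y = 0).
Proof.
have [->|x0] := eqVneq x 0; first by exists 0.
have [a xa] := residue_surj x.
have nMa : ~ M (val a).
  move=> Ma; move/eqP: x0; apply; rewrite xa -(rmorph0 (residue sA hM)).
  by apply/residue_eq; rewrite rmorph0 subr0.
have [y Ay My] := maximal_inv sA hM (set_mem (valP a)) nMa.
exists (residue sA hM (Sub y (mem_set Ay))); split=> [_|/eqP]; last first.
  by rewrite (negPf x0).
rewrite xa -rmorphM -(rmorph1 (residue sA hM)); apply/residue_eq.
by rewrite rmorphM rmorph1.
Qed.

Definition residue_inv (x : K) : K := projT1 (cid (residue_has_inv x)).

Lemma residue_mulVf (x : K) : x != 0 -> residue_inv x * x = 1.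
Proof. by rewrite /residue_inv; case: cid => y [yP _] /= /eqP/yP. Qed.

Lemma residue_invr0 : residue_inv 0 = 0.
Proof. by rewrite /residue_inv; case: cid => y [_ yP] /=; apply: yP. Qed.

HB.instance Definition _ :=
  GRing.ComNzRing_isField.Build K residue_mulVf residue_invr0.

End ResidueFieldInstance.

(* The embedding A/M -> B/M induced by A `<=` B, x + M |-> x + M. *)
Section ResidueMap.
Variables (L : fieldType) (A B M : set L).
Variables (sA : subring A) (sB : subring B) (AB : A `<=` B).
Variables (hA : maximal_ideal A M) (hB : maximal_ideal B M).

Definition subring_incl (a : subring_type sA) : subring_type sB :=
  Sub (val a) (mem_set (AB (set_mem (valP a)))).

Lemma val_subring_incl a : val (subring_incl a) = val a.
Proof. by []. Qed.

Lemma subring_inclB a b :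
  subring_incl (a - b) = subring_incl a - subring_incl b.
Proof.
by apply: val_inj; rewrite rmorphB !val_subring_incl rmorphB.
Qed.

Lemma subring_inclM a b :
  subring_incl (a * b) = subring_incl a * subring_incl b.
Proof.
by apply: val_inj; rewrite rmorphM !val_subring_incl rmorphM.
Qed.

Lemma subring_incl1 : subring_incl 1 = 1.
Proof. by apply: val_inj; rewrite val_subring_incl !rmorph1. Qed.

Definition residue_map (x : residue_field sA hA) : residue_field sB hB :=
  residue sB hB (subring_incl (repr x)).

Lemma residue_mapE a :
  residue_map (residue sA hA a) = residue sB hB (subring_incl a).
Proof.
rewrite /residue_map; set c := repr _.
have /residue_eq ca : residue sA hA c = residue sA hA a.
  by rewrite /c /residue reprK.
by apply/residue_eq; rewrite !val_subring_incl.
Qed.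

Lemma residue_map_zmod_morphism : zmod_morphism residue_map.
Proof.
move=> x y.
have [a ->] := residue_surj x; have [b ->] := residue_surj y.
by rewrite -rmorphB !residue_mapE -rmorphB subring_inclB.
Qed.

Lemma residue_map_monoid_morphism : monoid_morphism residue_map.
Proof.
split=> [|x y].
  by rewrite -(rmorph1 (residue sA hA)) residue_mapE subring_incl1 rmorph1.
have [a ->] := residue_surj x; have [b ->] := residue_surj y.
by rewrite -rmorphM !residue_mapE -rmorphM subring_inclM.
Qed.

HB.instance Definition _ :=
  GRing.isZmodMorphism.Build _ _ residue_map residue_map_zmod_morphism.
HB.instance Definition _ :=
  GRing.isMonoidMorphism.Build _ _ residue_map residue_map_monoid_morphism.

End ResidueMap.
Arguments residue_map {L A B M} sA sB AB hA hB x.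

(* The subfield k(alpha) of K, where k is identified with its image in K. *)
Definition adjoin (k K : fieldType) (iota : {rmorphism k -> K}) (alpha : K) :
    set K :=
  \bigcap_(S in [set S : set K | [/\ divring_closed (mem S),
                                     range iota `<=` S & S alpha]]) S.

(* Main.v *)
Require Import Defs.
From HB Require Import structures.
From mathcomp Require Import all_boot all_order all_algebra.
From mathcomp Require Import boolp classical_sets functions cardinality.
Set Implicit Arguments.
Unset Strict Implicit.
Unset Printing Implicit Defensive.
Import GRing.Theory.
Local Open Scope classical_set_scope.
Local Open Scope card_scope.
Local Open Scope ring_scope.

(** For a valuation domain V, sending a prime P to
    V_P = {x | x = 0 or x^-1 is not in P} is a bijection from the primes of V
    onto the overrings of V; its inverse sends T to the set of nonunits of T,
    which is also the conductor (R : T).  A proper ideal I of R lies in M, so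
    I^-1 contains M^-1 = V; hence the proper strongly divisorial ideals of R
    are exactly the nonzero primes of V, their inverses are the overrings of V
    other than L, and every overring of R is t-linked.  This gives (i) <-> (iv).
    If R c V is minimal and an overring T of R contains x outside V, then
    V x^-1 is contained in M, so T contains V; this gives (ii) <-> (iv).
    Finally the rings between R and V correspond to the subrings of K
    containing k, which gives (ii) <-> (iii).  In finite dimension a chain of
    primes of V of maximal length exhausts Spec V, as ideals of V are totally
    ordered by inclusion. *)

(** * Subrings of a field: ideals, products and colons *)

Section SubringTheory.
Variable L : fieldType.
Implicit Types (A I J T : set L).

Lemma subring_intro A : A 1 -> (forall x y, A x -> A y -> A (x - y)) ->
  (forall x y, A x -> A y -> A (x * y)) -> subring A.
Proof.
move=> A1 AB AM; split; first exact: mem_set.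
  by move=> x y /set_mem Ax /set_mem Ay; apply/mem_set/AB.
by move=> x y /set_mem Ax /set_mem Ay; apply/mem_set/AM.
Qed.

Lemma subring0 A : subring A -> A 0.
Proof.
by move=> sA; rewrite -(subrr 1); apply: subringB => //; apply: subring1.
Qed.

Lemma subringN A x : subring A -> A x -> A (- x).
Proof.
by move=> sA Ax; rewrite -sub0r; apply: subringB => //; apply: subring0.
Qed.

Lemma subringD A x y : subring A -> A x -> A y -> A (x + y).
Proof.
move=> sA Ax Ay; rewrite -[y]opprK.
by apply: subringB => //; apply: subringN.
Qed.

Lemma ideal_id A : subring A -> ideal A A.
Proof.
by move=> sA; split=> //; [exact: subring0|move=> x y; exact: subringD
  |move=> x y; exact: subringM].
Qed.

Lemma ideal_full A I : ideal A I -> I 1 -> I = A.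
Proof.
move=> [IA _ _ IM] I1; apply/seteqP; split=> // x Ax.
by rewrite -[x]mulr1; apply: IM.
Qed.

Lemma fg_ideal_ideal A I : subring A -> fg_ideal A I -> ideal A I.
Proof.
move=> sA [n [g [Ag ->]]]; split.
- move=> _ [c [Ac ->]]; elim/big_ind: _ => [|x y|i _]; first exact: subring0.
    exact: subringD.
  exact: subringM.
- exists (fun=> 0); split=> [_|]; first exact: subring0.
  by rewrite big1// => i _; rewrite mul0r.
- move=> _ _ [c [Ac ->]] [d [Ad ->]]; exists (fun i => c i + d i).
  split=> [i|]; first exact: subringD.
  by rewrite -big_split; apply: eq_bigr => i _; rewrite mulrDl.
- move=> a _ Aa [c [Ac ->]]; exists (fun i => a * c i).
  split=> [i|]; first exact: subringM.
  by rewrite mulr_sumr; apply: eq_bigr => i _; rewrite mulrA.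
Qed.

Lemma prod_ideal_mul I J x y : I x -> J y -> prod_ideal I J (x * y).
Proof.
by move=> Ix Jy; exists 1%N, (fun=> x), (fun=> y); rewrite big_ord1.
Qed.

Lemma prod_ideal_sub A T I J : ideal A T ->
  (forall x y, I x -> J y -> T (x * y)) -> prod_ideal I J `<=` T.
Proof.
move=> [_ T0 TD _] TM _ [n [a [b [Ia Jb ->]]]].
by elim/big_ind: _ => // i _; apply: TM.
Qed.

Lemma prod_ideal_idr A I : subring A -> ideal A I -> prod_ideal I A = I.
Proof.
move=> sA iI; have [_ _ _ IM] := iI; apply/seteqP; split.
  by apply: prod_ideal_sub iI _ => x y Ix Ay; rewrite mulrC; apply: IM.
by move=> x Ix; rewrite -[x]mulr1; apply: prod_ideal_mul => //; apply: subring1.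
Qed.

Lemma prod_ideal_overring A T : subring A -> overrings A T ->
  prod_ideal A T = T.
Proof.
move=> sA [sT AT]; apply/seteqP; split.
  by apply: (prod_ideal_sub (ideal_id sT)) => x y /AT Tx Ty; exact: subringM.
by move=> x Tx; rewrite -[x]mul1r; apply: prod_ideal_mul => //; apply: subring1.
Qed.

Lemma colon_id A : subring A -> colon A A = A.
Proof.
move=> sA; apply/seteqP; split=> x Ax.
  by rewrite -[x]mulr1; apply: Ax; apply: subring1.
by move=> y Ay; apply: subringM.
Qed.

Lemma colonS A I J : I `<=` J -> colon A J `<=` colon A I.
Proof. by move=> IJ x xJ y /IJ/xJ. Qed.

Lemma strongly_divisorial_id A : subring A -> strongly_divisorial A A.
Proof.
move=> sA; rewrite /strongly_divisorial /v_closure /inv_ideal /= !colon_id//.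
rewrite prod_ideal_idr//; last exact: ideal_id.
split=> //; first exact: ideal_id.
apply/eqP => A0; have := subring1 sA; rewrite A0 => /eqP.
by rewrite oner_eq0.
Qed.

(** As [I] equals its product with its inverse, elements of the inverse send [I] into [I] and not
    merely into [A]. Thus the inverse is [(I:I)], which is closed under products. *)
Lemma inv_ideal_overring A I : subring A -> strongly_divisorial A I ->
  overrings A (inv_ideal A I).
Proof.
move=> sA [iI _ eI _]; have [IA _ _ IM] := iI.
split; last by move=> a Aa y /IM-/(_ _ Aa)/IA.
apply: subring_intro.
- by move=> y /IA; rewrite mul1r.
- move=> x y Tx Ty z Iz; rewrite mulrBl.
  by apply: subringB; [|apply: Tx|apply: Ty].
move=> x y Tx Ty z Iz; rewrite -mulrA; apply: Tx.
by rewrite eI mulrC; apply: prod_ideal_mul.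
Qed.

End SubringTheory.

(** * Valuation rings: nonunits, overrings and primes *)

Section Valuation.
Variable L : fieldType.
Implicit Types (A I P R T V : set L).

(* For a valuation ring [V], this involution exchanges a prime ideal of [V]
   with the localization of [V] at it. *)
Definition noninv A : set L := [set x | x != 0 -> ~ A x^-1].

Lemma noninv0 A : noninv A 0.
Proof. by rewrite /noninv /= eqxx. Qed.

Lemma not_noninv A x : ~ noninv A x -> x != 0 /\ A x^-1.
Proof. by move=> /not_implyP[x0 /contrapT]. Qed.

(** The hypothesis is forced, since every value of [noninv] contains 0. *)
Lemma noninvK A : A 0 -> noninv (noninv A) = A.
Proof.
move=> A0; apply/seteqP; split=> x.
  have [->//|x0 /(_ x0)/not_noninv[_]] := eqVneq x 0.
  by rewrite invrK.
by move=> Ax x0; apply; rewrite ?invr_eq0 ?invrK.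
Qed.

Lemma noninvT : noninv setT = [set 0].
Proof.
apply/seteqP; split=> x; last by move=> ->; exact: noninv0.
by move=> nx; apply: contrapT => /eqP/nx; exact.
Qed.

(** No base ring is mentioned, so that the property passes to all overrings. *)
Definition valuation V : Prop :=
  subring V /\ forall x, x != 0 -> V x \/ V x^-1.

Lemma valuation_overrings V T : valuation V -> overrings V T -> valuation T.
Proof.
by move=> [_ vV] [sT VT]; split=> // x /vV[] /VT; [left|right].
Qed.

Lemma noninvS V T : V `<=` T -> noninv T `<=` noninv V.
Proof. by move=> VT x nx /nx nTx /VT. Qed.

Lemma noninv_sub V : valuation V -> noninv V `<=` V.
Proof.
move=> [sV vV] x; have [->|x0 /(_ x0) nx] := eqVneq x 0.
  by move=> _; exact: subring0.
by have [] := vV x x0.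
Qed.

(** For sums, one of [x / y] and [y / x] lies in [V], so [x + y] is a multiple in [V] of [y] or of
    [x]. *)
Lemma noninv_ideal V : valuation V -> ideal V (noninv V).
Proof.
move=> hV; have [sV vV] := hV.
have nM a x : V a -> noninv V x -> noninv V (a * x).
  move=> Va nx; rewrite /noninv /= mulf_eq0 => /norP[a0 x0] Vax.
  apply: (nx x0); rewrite -[x^-1](mulVKf a0) -invfM.
  exact: subringM.
split=> //; first exact: noninv_sub.
  exact: noninv0.
move=> x y nx ny.
have [->|x0] := eqVneq x 0; first by rewrite add0r.
have [->|y0] := eqVneq y 0; first by rewrite addr0.
have V1 := subring1 sV.
have [Vxy|] : V (x / y) \/ V (x / y)^-1.
- by apply: vV; rewrite mulf_neq0 ?invr_eq0.
- have -> : x + y = (x / y + 1) * y by rewrite mulrDl mul1r divfK.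
  by apply: nM => //; apply: subringD.
rewrite invf_div => Vyx.
have -> : x + y = (1 + y / x) * x by rewrite mulrDl mul1r divfK.
by apply: nM => //; apply: subringD.
Qed.

Lemma proper_ideal_noninv V I : ideal V I -> ~ I 1 -> I `<=` noninv V.
Proof.
by move=> [_ _ _ IM] I1 x Ix x0 Vx; apply: I1; rewrite -(mulVf x0); apply: IM.
Qed.

Lemma maximal_noninv V M : valuation V -> maximal_ideal V M -> M = noninv V.
Proof.
move=> hV [iM M1 maxM]; have [sV _] := hV.
have [//|NV] := maxM _ (noninv_ideal hV) (proper_ideal_noninv iM M1).
have : noninv V 1 by rewrite NV; exact: subring1.
by rewrite /noninv /= invr1 oner_neq0 => /(_ isT)[]; exact: subring1.
Qed.

(** The nonunits of [T] lie in [V] because [noninv] reverses inclusions. If neither [x] nor [y] is a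
    nonunit of [T], then [x^-1] and [y^-1] lie in [T], and so does their product. *)
Lemma noninv_prime V T : valuation V -> overrings V T ->
  prime_ideal V (noninv T).
Proof.
move=> hV hT; have [sT VT] := hT; have [sV _] := hV.
have [_ N0 ND NM] := noninv_ideal (valuation_overrings hV hT).
split.
- split=> //; last by move=> a x /VT; apply: NM.
  by apply: subset_trans (noninvS VT) _; exact: noninv_sub.
- by rewrite /noninv /= invr1 oner_neq0 => /(_ isT)[]; exact: subring1.
move=> x y _ _ nxy; apply: contrapT => /not_orP[/not_noninv[x0 Tx]].
move=> /not_noninv[y0 Ty]; apply: nxy; first by rewrite mulf_neq0.
by rewrite invfM; apply: subringM.
Qed.

(** Here [noninv P] is the localization of [V] at [P]. Differences reduce to products by factoring
    out [x] or [y], according to which quotient lies in [V]. *)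
Lemma prime_noninv V P : valuation V -> prime_ideal V P ->
  overrings V (noninv P).
Proof.
move=> [sV vV] [[PV P0 PD PM] P1 PP].
have VP : V `<=` noninv P.
  by move=> x Vx x0 Px; apply: P1; rewrite -(mulfV x0); apply: PM.
have NM x y : noninv P x -> noninv P y -> noninv P (x * y).
  move=> nx ny; rewrite /noninv /= mulf_eq0 invfM => /norP[x0 y0] Pxy.
  (* If [x] or [y] lies in [V], multiplying by it puts the other inverse in [P]; otherwise both
     inverses lie in [V] and primality applies. *)
  have [Vx|Vx] := vV x x0.
    by apply: (ny y0); rewrite -[y^-1](mulVKf x0); apply: PM.
  have [Vy|Vy] := vV y y0.
    by apply: (nx x0); rewrite -[x^-1](mulVKf y0) [y^-1 * _]mulrC; apply: PM.
  by have [] := PP _ _ Vx Vy Pxy; [exact: nx|exact: ny].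
split=> //; apply: subring_intro => //; first exact: VP _ (subring1 sV).
have NN1 : noninv P (- 1) by exact: VP _ (subringN sV (subring1 sV)).
move=> x y nx ny.
have [->|x0] := eqVneq x 0; first by rewrite sub0r -mulN1r; apply: NM.
have [->|y0] := eqVneq y 0; first by rewrite subr0.
have V1 := subring1 sV.
have [Vxy|] : V (x / y) \/ V (x / y)^-1.
- by apply: vV; rewrite mulf_neq0 ?invr_eq0.
- have -> : x - y = (x / y - 1) * y by rewrite mulrBl mul1r divfK.
  by apply: NM => //; apply: VP; apply: subringB.
rewrite invf_div => Vyx.
have -> : x - y = (1 - y / x) * x by rewrite mulrBl mul1r divfK.
by apply: NM => //; apply: VP; apply: subringB.
Qed.

(** Take [x] in [I] but not in [J]. For a nonzero [y] in [J], [x / y] cannot lie in [V], so [y / x]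
    does and [y] lies in [I]. *)
Lemma ideal_total V I J : valuation V -> ideal V I -> ideal V J ->
  I `<=` J \/ J `<=` I.
Proof.
move=> [_ vV] [_ I0 _ IM] [_ J0 _ JM].
have [|/existsNP[x /not_implyP[Ix nJx]]] := pselect (I `<=` J); first by left.
right=> y Jy; have [->//|y0] := eqVneq y 0.
have x0 : x != 0 by apply: contra_notN nJx => /eqP->.
have [Vxy|] : V (x / y) \/ V (x / y)^-1.
- by apply: vV; rewrite mulf_neq0 ?invr_eq0.
- by case: nJx; rewrite -[x](divfK y0); apply: JM.
by rewrite invf_div => Vyx; rewrite -[y](divfK x0); apply: IM.
Qed.

Lemma noninv_nonzero T : T 0 -> T <> setT -> noninv T <> [set 0].
Proof.
by move=> T0 TL N0; apply: TL; rewrite -(noninvK T0) N0 -noninvT noninvK.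
Qed.

(** * Conductors of overrings of [V] and of their maximal ideals *)

Section Conductor.
Variables R V : set L.
Hypotheses (hV : valuation V) (nVR : ~ V `<=` R) (MR : noninv V `<=` R).

(** If [x^-1] lies in [T], then [x T] contains [T], hence [V], and cannot lie in [R]. If [x] is a
    nonunit of [T], then [x T] lies in [noninv V]. *)
Lemma colon_overring T : overrings V T -> colon R T = noninv T.
Proof.
move=> hT; have hvT := valuation_overrings hV hT; have [sT VT] := hT.
have [_ _ _ NM] := noninv_ideal hvT.
apply/seteqP; split=> x.
  move=> Rx; apply: contrapT => /not_noninv[x0 Tx]; apply: nVR => v /VT Tv.
  by rewrite -[v](mulVKf x0); apply: Rx; apply: subringM.
by move=> nx y Ty; rewrite mulrC; apply: MR; apply: noninvS (VT) _ _; apply: NM.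
Qed.

Lemma colon_noninv T : overrings V T -> colon R (noninv T) = T.
Proof.
move=> hT; have hvT := valuation_overrings hV hT; have [sT VT] := hT.
have [_ _ _ NM] := noninv_ideal hvT.
apply/seteqP; split=> x; last first.
  by move=> Tx y ny; apply: MR; apply: noninvS (VT) _ _; apply: NM.
move=> Rx; apply: contrapT => nTx.
have x0 : x != 0 by apply: contra_notN nTx => /eqP->; exact: subring0.
have [//|Tx] := hvT.2 x x0.
(* As [x] is not in [T], its inverse is a nonunit of [T]; so [v / x] is one too, and [x] sends it to
   [v], which would put all of [V] in [R]. *)
apply: nVR => v /VT Tv; rewrite -[v](mulVKf x0) [_ * v]mulrC.
apply: Rx; apply: NM => // _.
by rewrite invrK.
Qed.

End Conductor.
End Valuation.

(** * Prime chains of maximal length *)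

Lemma prime_in_maximal_chain (L : fieldType) (V P : set L) (n : nat) C :
  valuation V -> prime_chain V n C ->
  (forall m D, prime_chain V m D -> (m <= n)%N) ->
  prime_ideal V P -> exists2 i, (i <= n)%N & P = C i.
Proof.
move=> hV [pC sC] nmax pP; apply: contrapT => nP.
have nPC i : (i <= n)%N -> P <> C i by move=> le_in e; apply: nP; exists i.
(* [P] goes just before the first [C j] not contained in it. The disjunct [n < j] supplies an index
   when [P] contains the whole chain. *)
have exj : exists j, `[< (n < j)%N \/ ~ C j `<=` P >].
  by exists n.+1; apply/asboolP; left.
pose j := ex_minn exj.
have Cj i : (i < j)%N -> (i <= n)%N /\ C i `<=` P.
  rewrite /j; case: ex_minnP => m _ minm im.
  have : ~ ((n < i)%N \/ ~ C i `<=` P).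
    by move=> /asboolP/minm; rewrite leqNgt im.
  by move=> /not_orP[/negP]; rewrite -leqNgt => ? /contrapT.
have jP : (j <= n)%N -> P `<` C j.
  rewrite /j; case: ex_minnP => m /asboolP mP _ mn.
  have nCP : ~ C m `<=` P by case: mP => //; rewrite ltnNge mn.
  split=> //; have [[iP _ _] [iC _ _]] := (pP, pC _ mn).
  by have [] := ideal_total hV iP iC.
have jn : (j <= n.+1)%N.
  by case: (leqP j n.+1) => // /Cj[]; rewrite ltnn.
(* Inserting [P] at place [j] and shifting the rest yields a chain of length [n.+1], against
   [nmax]. *)
pose D i := if (i < j)%N then C i else if i == j then P else C i.-1.
suff /nmax : prime_chain V n.+1 D by rewrite ltnn.
split=> i le_in.
  rewrite /D; case: ltngtP => // [/Cj[ij _]|ji]; first exact: pC.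
  by apply: pC; rewrite -ltnS (leq_trans _ le_in)// prednK// (leq_ltn_trans _ ji).
rewrite /D; case: (ltngtP i j) => [ij|ji|eij].
- have [ij' CP] := Cj i ij.
  case: (ltngtP i.+1 j) => [iSj|jSi|_].
  + by apply: sC; have [] := Cj _ iSj.
  + by move: jSi; rewrite ltnS leqNgt ij.
  + split=> // PC; apply: (nPC i) => //; exact/seteqP.
- rewrite ltnNge (ltnW (ltnW _))//= gtn_eqF; last exact: ltnW.
  case: i ji le_in => // i ji le_in /=; exact: sC.
- by rewrite eij ltnNge leqnSn/= gtn_eqF//=; apply: jP; rewrite -eij -ltnS.
Qed.

(** * Field extensions without intermediate rings *)

Section FieldExtension.
Variables (k K : fieldType) (iota : {rmorphism k -> K}).

Lemma subring_horner (S : set K) (p : {poly k}) x : subring S ->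
  range iota `<=` S -> S x -> S (map_poly iota p).[x].
Proof.
move=> sS kS Sx; elim/poly_ind: p => [|p c IHp].
  by rewrite rmorph0 horner0; exact: subring0.
rewrite rmorphD rmorphM/= map_polyX map_polyC/= !hornerE.
apply: subringD => //; first exact: subringM.
by apply: kS; exists c.
Qed.

(** From [p(x) x + c = 0] with [c] nonzero, [x^-1 = - c^-1 p(x)]. When [c] is zero, [x] cancels and
    the induction goes on with [p]. *)
Lemma subring_inv_algebraic (S : set K) x : subring S -> range iota `<=` S ->
  S x -> algebraicOver iota x -> S x^-1.
Proof.
move=> sS kS Sx [p p0 px].
have [->|x0] := eqVneq x 0; first by rewrite invr0; exact: subring0.
elim/poly_ind: p p0 px => [|p c IHp]; first by rewrite eqxx.
rewrite /root rmorphD rmorphM/= map_polyX map_polyC/= !hornerE => p0.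
have [c0|c0] := eqVneq c 0.
  move: p0; rewrite c0 rmorph0 addr0 mulf_eq0 negb_or => /andP[p0 _].
  by rewrite rmorph0 addr0 mulf_eq0 (negPf x0) orbF; exact: IHp.
rewrite addr_eq0 => /eqP pxc.
have -> : x^-1 = iota (- c^-1) * (map_poly iota p).[x].
  apply: (mulIf x0); rewrite mulVf// -mulrA pxc -rmorphN -rmorphM.
  by rewrite mulrNN mulVf// rmorph1.
by apply: subringM => //; [apply: kS; exists (- c^-1)|exact: subring_horner].
Qed.

Lemma subring_polys x : subring [set (map_poly iota p).[x] | p in setT].
Proof.
apply: subring_intro.
- by exists 1 => //; rewrite rmorph1 hornerE.
- by move=> _ _ [p _ <-] [q _ <-]; exists (p - q) => //; rewrite rmorphB !hornerE.
- by move=> _ _ [p _ <-] [q _ <-]; exists (p * q) => //; rewrite rmorphM !hornerE.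
Qed.

(** For [x] outside [k], minimality gives [k[x] = K], so [x^-1 = p(x)] and [x] is a root of
    [p X - 1]. Conversely, a ring between [k] and an algebraic extension is a field, so it contains
    [k(x)] for each of its elements [x]. *)
Lemma no_intermediate_subringP :
  (forall S, subring S -> range iota `<=` S -> S = range iota \/ S = setT) <->
  (forall x, algebraicOver iota x) /\
    (forall x, ~ range iota x -> adjoin iota x = setT).
Proof.
split=> [minK|[algK adjK] S sS kS].
  have polysT x : ~ range iota x ->
      [set (map_poly iota p).[x] | p in setT] = setT.
    move=> nkx; have [_ [c _ <-]||//] := minK _ (subring_polys x).
      by exists c%:P => //; rewrite map_polyC/= hornerC.
    move=> e; case: nkx; rewrite -e.
    by exists 'X => //; rewrite map_polyX hornerX.
  split=> x => [|nkx].
    have [[c _ <-]|nkx] := pselect (range iota x).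
      exists ('X - c%:P); first by rewrite polyXsubC_eq0.
      by rewrite rmorphB/= map_polyX map_polyC/= root_XsubC.
    have x0 : x != 0.
      by apply: contra_notN nkx => /eqP->; exists 0; rewrite ?rmorph0.
    have : setT x^-1 by [].
    rewrite -(polysT x nkx) => -[p _ px]; exists (p * 'X - 1).
      (* The polynomial is nonzero because its value at 0 is -1. *)
      apply/eqP => /(congr1 (horner^~ 0)) /eqP.
      by rewrite !hornerE oppr_eq0 oner_eq0.
    rewrite /root rmorphB rmorphM rmorph1/= map_polyX !hornerE px.
    by rewrite mulVf// subrr.
  apply/seteqP; split=> // y _ S [dS kS Sx].
  have : setT y by [].
  rewrite -(polysT x nkx) => -[p _ <-]; apply: subring_horner => //.
  exact: (GRing.divring_closedBM dS).
have [Sk|/existsNP[x /not_implyP[Sx nkx]]] := pselect (S `<=` range iota).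
  by left; apply/seteqP.
right; apply/seteqP; split=> // y _.
have : setT y by [].
(* [S] is among the sets intersected in [adjoin iota x], since [algK] makes it closed under
   division. *)
rewrite -(adjK x nkx); apply; split=> //.
have [S1 SB SM] := sS; split=> // u v Su Sv; apply: SM => //.
apply: mem_set; apply: subring_inv_algebraic => //; exact: set_mem.
Qed.

End FieldExtension.

(** * Rings between [R] and [V] and subrings of the residue field *)

(** The kernel [M] of the map from [V] to [K] lies in [R], so a ring between [R] and [V] is a union
    of cosets of [M] and is recovered from its image in [K]. *)
Lemma minimal_residueP (L : fieldType) (R V M : set L) (sR : subring R)
    (sV : subring V) (RV : R `<=` V) (hM : maximal_ideal R M)
    (hMV : maximal_ideal V M) (K := residue_field sV hMV)
    (iota := residue_map sR sV RV hM hMV : {rmorphism _ -> K}) :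
  ~ V `<=` R ->
  minimal_extension R V <->
  (forall S : set K, subring S -> range iota `<=` S ->
     S = range iota \/ S = setT).
Proof.
move=> nVR; have [[MR _ _ _] _ _] := hM.
have iotaE a (Ra : R (val a)) :
    iota (residue sR hM (Sub (val a) (mem_set Ra))) = residue sV hMV a.
  rewrite /iota /= residue_mapE; congr residue; exact: val_inj.
split=> [[_ minV] S sS kS|minK].
  pose T := [set val a | a in [set a | S (residue sV hMV a)]].
  have sT : subring T.
    apply: subring_intro.
    - exists 1; last by rewrite rmorph1.
      by rewrite /= rmorph1; exact: subring1.
    - move=> _ _ [a Sa <-] [b Sb <-]; exists (a - b); rewrite ?rmorphB//= rmorphB.
      exact: subringB.
    - move=> _ _ [a Sa <-] [b Sb <-]; exists (a * b); rewrite ?rmorphM//= rmorphM.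
      exact: subringM.
  have RT : R `<=` T.
    move=> x Rx; exists (Sub x (mem_set (RV _ Rx))); last by rewrite SubK.
    by apply: kS; rewrite /= -iotaE; eexists.
  have TV : T `<=` V by move=> _ [a _ <-]; exact: set_mem (valP a).
  have [TR|TV'] := minV T sT RT TV; [left|right].
    apply/seteqP; split=> // x; have [a ->] := residue_surj x => Sa.
    have Ra : R (val a) by rewrite -TR; exists a.
    by rewrite -(iotaE a Ra); eexists.
  apply/seteqP; split=> // x _; have [a ->] := residue_surj x.
  have : T (val a) by rewrite TV'; exact: set_mem (valP a).
  by case=> b Sb /val_inj <-.
split=> // T sT RT TV.
pose S : set K := [set residue sV hMV a | a in [set a | T (val a)]].
have sS : subring S.
  apply: subring_intro.
  - by exists 1; rewrite /= ?rmorph1//; exact: subring1.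
  - move=> _ _ [a Ta <-] [b Tb <-]; exists (a - b); last by rewrite rmorphB.
    by rewrite /mkset rmorphB; apply: subringB.
  - move=> _ _ [a Ta <-] [b Tb <-]; exists (a * b); last by rewrite rmorphM.
    by rewrite /mkset rmorphM; apply: subringM.
(* Two elements with the same residue differ by an element of [M], which lies in [T]. *)
have ST a : S (residue sV hMV a) -> T (val a).
  move=> [b Tb /residue_eq/MR/RT Tba].
  by rewrite -[val a](subKr (val b)); apply: subringB.
have kS : range iota `<=` S.
  move=> _ [z _ <-]; have [r ->] := residue_surj z.
  rewrite /iota /= residue_mapE; eexists; last by [].
  by apply: RT; exact: set_mem (valP r).
have [Sk|ST'] := minK S sS kS; [left|right]; apply/seteqP; split=> // x;
  last first.
  by move=> Vx; apply: (ST (Sub x (mem_set Vx))); rewrite ST'.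
move=> Tx; pose a : subring_type sV := Sub x (mem_set (TV _ Tx)).
have : S (residue sV hMV a) by exists a.
rewrite Sk => -[z _]; have [r ->] := residue_surj z.
rewrite /iota /= residue_mapE => /residue_eq/MR.
rewrite val_subring_incl => Rrx; rewrite -[x](subKr (val r)).
by apply: subringB => //; exact: set_mem (valP r).
Qed.

(** * Overrings and strongly divisorial ideals of [R] *)

Section PseudoValuation.
Variables (L : fieldType) (R V M : set L).
Hypotheses (sR : subring R) (hV : valuation V) (RV : R `<=` V).
Hypotheses (nVR : ~ V `<=` R).
Hypotheses (hM : maximal_ideal R M) (hMV : maximal_ideal V M).

Let sV : subring V := hV.1.
Let ME : M = noninv V := maximal_noninv hV hMV.

Let VV : overrings V V.
Proof. by split. Qed.

Let NR : noninv V `<=` R.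
Proof. by rewrite -ME; case: hM => -[]. Qed.

(** Choose [y] in [R] with [y x - 1] in [M]. Then [x^-1] differs from [y] by [x^-1 (y x - 1)], which
    lies in [M] because [x^-1] is in [V] and [M] is an ideal of [V]. *)
Lemma pvd_invr x : R x -> ~ M x -> R x^-1.
Proof.
move=> Rx nMx; have [y Ry My] := maximal_inv sR hM Rx nMx.
have [x0 Vx] : x != 0 /\ V x^-1 by apply: not_noninv; rewrite -ME.
have -> : x^-1 = y - x^-1 * (y * x - 1).
  by rewrite mulrBr mulr1 mulrC mulfK// opprB addrC subrK.
apply: subringB => //; apply: NR; rewrite -ME.
by have [[_ _ _ MM] _ _] := hMV; apply: MM.
Qed.

Lemma pvd_proper_ideal I : ideal R I -> ~ I 1 -> I `<=` noninv V.
Proof.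
move=> [IR _ _ IM] I1 x Ix; rewrite -ME; apply: contrapT => nMx.
have x0 : x != 0.
  by apply: contra_notN nMx => /eqP->; have [[]] := hM.
apply: I1; rewrite -(mulVf x0); apply: IM => //.
by apply: pvd_invr nMx; exact: IR.
Qed.

(** A proper ideal lies in [M], so its inverse contains [(R:M) = V] and is not [R]. Only [I = R] has
    to be tested. *)
Lemma pvd_overring_t_linked : overrings R `<=` t_linked_overrings R.
Proof.
move=> T hT; have [sT RT] := hT; split=> // I /(fg_ideal_ideal sR) iI IR.
have [I1|nI1] := pselect (I 1); last first.
  case: nVR; rewrite -IR -(colon_noninv hV nVR NR VV).
  by apply: colonS; exact: pvd_proper_ideal.
by rewrite (ideal_full iI I1) prod_ideal_overring// colon_id.
Qed.

Lemma inv_noninv T : overrings V T -> inv_ideal R (noninv T) = T.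
Proof. exact: colon_noninv. Qed.

(** The inverse is [T], the product with [T] changes nothing in an ideal of [T], and [(R:T)] is
    [noninv T] again. *)
Lemma noninv_strongly_divisorial T : overrings V T -> T <> setT ->
  strongly_divisorial R (noninv T).
Proof.
move=> hT TL; have [sT VT] := hT.
have hvT := valuation_overrings hV hT.
have [_ N0 ND NM] := noninv_ideal hvT.
split.
- split=> // [|a x /RV/VT]; last exact: NM.
  exact: subset_trans (noninvS VT) NR.
- by apply/eqP/noninv_nonzero => //; exact: subring0.
- by rewrite inv_noninv// prod_ideal_idr//; exact: noninv_ideal.
- by rewrite /v_closure inv_noninv// /inv_ideal (colon_overring hV nVR NR).
Qed.

(** Take for [T] the inverse of [I], which contains [V] because [I] lies in [M]; then
    [I = (R:T) = noninv T] by divisoriality. [T = L] would make [I] zero. *)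
Lemma strongly_divisorial_noninv I : strongly_divisorial R I -> ~ I 1 ->
  exists T, [/\ overrings V T, T <> setT & I = noninv T].
Proof.
move=> sdI I1; have [iI I0 _ Iv] := sdI.
have hT : overrings V (inv_ideal R I).
  split; first exact: (inv_ideal_overring sR sdI).1.
  rewrite -{1}(inv_noninv VV); by apply: colonS; exact: pvd_proper_ideal.
have IN : I = noninv (inv_ideal R I).
  by rewrite {1}Iv /v_closure {1}/inv_ideal (colon_overring hV nVR NR).
exists (inv_ideal R I); split=> // TL.
by move/eqP: I0; apply; rewrite IN TL noninvT.
Qed.

Lemma strongly_divisorialE :
  strongly_divisorial R = nonzero_primes V `|` [set R].
Proof.
apply/seteqP; split=> I.
  move=> sdI; have [iI I0 _ _] := sdI.
  have [I1|I1] := pselect (I 1); first by right; exact: ideal_full.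
  left; have [T [hT _ IT]] := strongly_divisorial_noninv sdI I1.
  by split; [rewrite IT; exact: noninv_prime|exact/eqP].
move=> [[pI I0]|->]; last exact: strongly_divisorial_id.
have I00 : I 0 by case: pI => -[].
rewrite -(noninvK I00); apply: noninv_strongly_divisorial.
  exact: prime_noninv.
by move=> IT; apply: I0; rewrite -(noninvK I00) IT noninvT.
Qed.

(** The values of [phi_R] are [R], at the unit ideal, and the overrings of [V] other than [L]; and
    [L] itself is an overring of [V]. *)
Lemma phi_surjectiveP :
  phi_surjective R <-> overrings R = [set R] `|` overrings V.
Proof.
split=> [surj|OR T [[/= hT _]]].
  apply/seteqP; split=> T; last first.
    by move=> [->|[sT VT]]; split=> //; exact: subset_trans VT.
  move=> hT; have [TL|TL] := pselect (T = setT).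
    by right; rewrite TL; split=> //; rewrite -TL; case: hT.
  have [|I sdI <-] := surj T; first by split=> //; exact: pvd_overring_t_linked.
  have [I1|I1] := pselect (I 1).
    left; have [iI _ _ _] := sdI.
    by rewrite (ideal_full iI I1) /inv_ideal colon_id.
  right; have [U [hU _ ->]] := strongly_divisorial_noninv sdI I1.
  by rewrite inv_noninv.
move=> TL; have : overrings R T by [].
rewrite OR => -[->|hVT].
  by exists R; [exact: strongly_divisorial_id|exact: colon_id].
by exists (noninv T); [exact: noninv_strongly_divisorial|exact: inv_noninv].
Qed.

(** Minimality is applied to the intersection of [T] with [V]. *)
Lemma minimal_extensionP :
  minimal_extension R V <-> overrings R = [set R] `|` overrings V.
Proof.
split=> [[_ minV]|OR].
  apply/seteqP; split=> T; last first.
    by move=> [->|[sT VT]]; split=> //; exact: subset_trans VT.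
  move=> [sT RT].
  have sTV : subring (T `&` V).
    apply: subring_intro.
    - by split; exact: subring1.
    - by move=> x y [? ?] [? ?]; split; exact: subringB.
    - by move=> x y [? ?] [? ?]; split; exact: subringM.
  have [||TVR|TV] := minV _ sTV; first by move=> x Rx; split; auto.
  - exact: subIsetr.
  - left; apply/seteqP; split=> // x Tx; rewrite -TVR; split=> //.
    (* For [x] in [T] outside [V], [x^-1] is a nonunit of [V], so [v / x] lies in [M] and thus in
       [T]; then [v] lies in [T] and [V], that is, in [R]. *)
    apply: contrapT => nVx; case: nVR => v Vv; rewrite -TVR; split=> //.
    have x0 : x != 0 by apply: contra_notN nVx => /eqP->; exact: subring0.
    have Nx : noninv V x^-1 by rewrite /noninv /= invrK.
    have [_ _ _ NM] := noninv_ideal hV.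
    rewrite -[v](divfK x0); apply: subringM => //.
    by apply/RT/NR/NM.
  - by right; split=> //; rewrite -TV; exact: subIsetl.
split=> // T sT RT TV; have : overrings R T by [].
by rewrite OR => -[->|[_ VT]]; [left|right; apply/seteqP].
Qed.

End PseudoValuation.

(** * The spectrum of a finite-dimensional valuation ring *)

Lemma chain_lt (L : fieldType) (n : nat) (C : nat -> set L) :
  (forall i, (i < n)%N -> C i `<` C i.+1) ->
  forall i j, (i < j <= n)%N -> C i `<` C j.
Proof.
move=> sC i; elim=> // j IHj /andP[].
rewrite ltnS leq_eqVlt => /predU1P[<-|ij] jn.
  exact: sC.
have [|Cij _] := IHj; first by rewrite ij ltnW.
have [CjS nCjS] := sC _ jn.
by split=> [|CSi]; [exact: subset_trans CjS|exact: nCjS (subset_trans CSi Cij)].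
Qed.

Lemma spec_finite_dim (L : fieldType) (V : set L) n : valuation V ->
  krull_dim V n -> exists C : nat -> set L,
    [/\ forall i j, (i < j <= n)%N -> C i `<` C j, C 0%N = [set 0],
        C n = noninv V & spec V = C @` `I_n.+1].
Proof.
move=> hV [[C hC] nmax]; have [pC /chain_lt sC] := hC; have [sV _] := hV.
have inC := prime_in_maximal_chain hV hC nmax.
have leC i j : (i <= j <= n)%N -> C i `<=` C j.
  move=> /andP[]; rewrite leq_eqVlt => /predU1P[->|ij] jn //.
  by apply: properW; apply: sC; rewrite ij.
exists C; split=> //.
(* The zero ideal is prime, being [noninv] of the overring [L]; it must therefore occur in the
   chain, hence at its bottom. *)
- have [|i ile e] := inC [set 0].
    rewrite -noninvT; apply: noninv_prime => //.
    by split=> //; exact: subring_intro.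
  apply/seteqP; split; first by rewrite e; exact: leC.
  by move=> _ ->; have [[]] := pC 0%N isT.
- have VV : overrings V V by split.
  have [i ile e] := inC _ (noninv_prime hV VV).
  apply/seteqP; split; last by rewrite e; apply: leC; rewrite ile/=.
  by have [iC C1 _] := pC n (leqnn n); exact: proper_ideal_noninv iC C1.
apply/seteqP; split=> P; first by move=> /inC[i ile ->]; exists i.
by move=> [i ile <-]; exact: pC.
Qed.

(** * Cycle of implications, and the count in finite dimension *)

Theorem theorem4p5 (L : fieldType) (R V M : set L)
    (sR : subring R) (fracR : quotient_field R) (nfR : ~ is_field R)
    (hV : pvd_with R V) (hM : maximal_ideal R M) (RV : R `<` V) :
  let sV := pvd_with_subring hV in
  let k := residue_field sR hM in
  let K := residue_field sV (pvd_with_maximal sR hV hM) in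
  let iota : {rmorphism k -> K} :=
    residue_map sR sV (pvd_with_sub hV) hM (pvd_with_maximal sR hV hM) in
  [<-> phi_surjective R;
       minimal_extension R V;
       (forall x : K, algebraicOver iota x) /\
         (forall alpha : K, ~ range iota alpha -> adjoin iota alpha = [set: K]);
       overrings R = [set R] `|` overrings V]
  /\ (phi_surjective R -> forall n : nat, krull_dim V n ->
        FO_domain R /\
        exists P : 'I_n.-1 -> set L,
          [/\ nonzero_primes R = range P `|` [set M],
              strongly_divisorial R = range P `|` [set M; R]
            & strongly_divisorial R #= `I_n.+1]).
Proof.
move=> sV k K iota; have [RsV nVR] := RV; have [[[_ _] vV] specE] := hV.
have hMV := pvd_with_maximal sR hV hM.
have hvV : valuation V by split.
have phiP := phi_surjectiveP sR hvV RsV nVR hM hMV.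
have minP := minimal_extensionP sR hvV RsV nVR hM hMV.
have resP := minimal_residueP sR sV (pvd_with_sub hV) hM
  (pvd_with_maximal sR hV hM) nVR.
have algP := no_intermediate_subringP iota.
split.
  (* [phiP] and [minP] both characterize the last condition, which links the first two; [resP] and
     [algP] pass to residue fields. *)
  tfae.
  - by move=> /phiP/minP.
  - by move=> /resP/algP.
  - by move=> /algP/resP/minP.
  - by move=> /phiP.
move=> /phiP OR n /(spec_finite_dim hvV)[C [sC C0 Cn specV]].
have ME : M = noninv V := maximal_noninv hvV hMV.
(* If [n] were 0, [M] would be [C 0], that is zero, and [R] would be a field. *)
have n_gt0 : (0 < n)%N.
  rewrite lt0n; apply/eqP => n0; apply: nfR => x Rx /eqP x0.
  apply: (pvd_invr sR hvV hM hMV) => //; rewrite ME -Cn n0 C0; exact: x0.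
have injC i j : (i <= n)%N -> (j <= n)%N -> C i = C j -> i = j.
  move=> ile jle eC; case: (ltngtP i j) => // [ij|ji].
    by have [|_] := sC i j; rewrite ?ij// eC; case.
  by have [|_] := sC j i; rewrite ?ji// eC; case.
have nzE P : nonzero_primes V P <-> exists2 i, (0 < i <= n)%N & P = C i.
  rewrite /nonzero_primes specV; split.
    move=> [[i ile <-] nC]; exists i => //; rewrite lt0n andbC -ltnS ile/=.
    by apply/eqP => i0; apply: nC; rewrite i0.
  move=> [i /andP[i0 ile] ->]; split; first by exists i.
  by move=> e; move: i0; rewrite (injC i 0%N)// C0.
have sdE := strongly_divisorialE sR hvV RsV nVR hM hMV.
have nR i : (i <= n)%N -> C i <> R.
  move=> ile CR; have : spec V (C i) by rewrite specV; exists i.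
  by move=> [_ + _]; rewrite CR; apply; exact: subring1.
have nzR : nonzero_primes R = nonzero_primes V by rewrite /nonzero_primes specE.
(* [C 0] is zero and [C n] is [M], so the other nonzero primes are [C 1] to [C n.-1], whence the
   shift on ['I_n.-1]. *)
have nzPM : nonzero_primes V =
    range (fun i : 'I_n.-1 => C i.+1) `|` [set M].
  apply/seteqP; split=> P.
    move=> /nzE[i /andP[i0 ile] ->].
    move: ile; rewrite leq_eqVlt => /predU1P[->|iln]; first by right; rewrite ME.
    have iln' : (i.-1 < n.-1)%N by rewrite -ltnS !prednK.
    by left; exists (Ordinal iln') => //=; rewrite prednK.
  move=> [[i _ <-]|->]; apply/nzE.
    by exists i.+1 => //=; rewrite (leq_trans (ltn_ord i))// leq_pred.
  by exists n; rewrite ?n_gt0 ?leqnn// ME.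
split.
  rewrite /FO_domain OR finite_setU; split; first exact: finite_set1.
  (* Each overring of [V] is recovered from its prime by [noninvK], so a finite spectrum leaves
     finitely many overrings. *)
  have ON : overrings V `<=` @noninv L @` spec V.
    move=> T hT; exists (noninv T); first exact: noninv_prime.
    by rewrite noninvK//; apply: subring0; case: hT.
  apply: sub_finite_set ON _; rewrite specV.
  by do 2 apply: finite_image.
exists (fun i : 'I_n.-1 => C i.+1); split; first by rewrite nzR.
  by rewrite sdE nzPM setUA.
(* [D] lists the [n] nonzero primes and then [R] in the last place, without repetition by [injC] and
   [nR]. *)
pose D i := if (i < n)%N then C i.+1 else R.
have -> : strongly_divisorial R = D @` `I_n.+1.
  rewrite sdE; apply/seteqP; split=> I.
    move=> [/nzE[i /andP[i0 ile] ->]|->]; last first.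
      by exists n; [exact: ltnSn|rewrite /D ltnn].
    exists i.-1; first by rewrite /= ltnS (leq_trans (leq_pred _)).
    by rewrite /D -ltnS prednK ?ltnS ?ile.
  move=> [i _ <-]; rewrite /D; case: ltnP => [iln|_]; last by right.
  by left; apply/nzE; exists i.+1.
apply: inj_card_eq => i j /set_mem ile /set_mem jle; rewrite /D.
case: ltnP => [iln|nli]; case: ltnP => [jln|nlj].
- by move=> /injC -/(_ iln jln)[].
- by move=> /nR-/(_ iln).
- by move=> /esym/nR-/(_ jln).
- by move=> _; apply/eqP; rewrite eqn_leq (leq_trans _ nlj)// (leq_trans _ nli).
Qed.
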